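(* Let $L/K$ be a degree $2$ Galois extension of fields with Galois group generated by $\sigma$. Assume either $\mathrm{char}(L)\ne 2$ or that $L$ is perfect. Assume that $\langle\ ,\ \rangle$ is definite up to $2$, and let $M\in M_{2,2}(L)$ have a unique eigenvalue $c$ in an algebraic closure $\overline{L}$ of $L$. Then $c\in L$. Assume also that either $\Delta_2=\Delta$ or $M$ has an eigenvector $u\in L^2$ with $\langle u,u\rangle\in\Delta$. Then either $M=c\,\mathbb{I}_{2\times 2}$ and $\mathrm{Num}(M)=\{c\}$, or $\mathrm{Num}(M)$ is, up to an affine transformation of $L$, a $\Delta$-ellipse with a unique focus (i.e. there are $e,f\in L$ with $f\ne 0$ such that $(\mathrm{Num}(M)-e)/f$ is a $\Delta$-ellipse with a unique focus at $0$).
   Context: $\mathbb{I}_{2\times 2}$ is the $2\times 2$ identity matrix. For $u,v\in L^n$ set $\langle u,v\rangle:=\sum_{i=1}^n\sigma(u_i)v_i$. The form $\langle\ ,\ \rangle$ is definite up to $n$ if $\langle u,u\rangle\ne 0$ for all $u\in L^n\setminus\{0\}$. The numerical range of an $n\times n$ matrix $M$ over $L$ is $\mathrm{Num}(M):=\{\langle u,Mu\rangle \mid u\in L^n,\ \langle u,u\rangle=1\}\subseteq L$. $\Delta:=\{a\sigma(a)\mid a\in L\}\subseteq K$, and $\Delta_2$ is the set of sums of two elements of $\Delta$. A $\Delta$-ellipse with a unique focus at $0$ is a subset of $L$ of the form $\{\sigma(x)y\mid (x,y)\in L^2,\ \delta_1x\sigma(x)+\delta_2y\sigma(y)=1\}$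 for some $\delta_1,\delta_2\in\Delta\setminus\{0\}$. *)

(* Defs.v *)
From HB Require Import structures.
From mathcomp Require Import all_boot all_order all_algebra all_fingroup all_field.
From mathcomp Require Import boolp classical_sets.

Set Implicit Arguments.
Unset Strict Implicit.
Unset Printing Implicit Defensive.

Import GRing.Theory.
Local Open Scope classical_set_scope.
Local Open Scope ring_scope.

Definition perfect_field (F : fieldType) : Prop :=
  forall p : {poly F}, irreducible_poly p -> separable_poly p.

(* An embedding of F in an algebraically closed field, algebraic over F. *)
Definition algebraic_closure (F : fieldType) (Fbar : closedFieldType)
    (iota : {rmorphism F -> Fbar}) : Prop :=
  forall x : Fbar, algebraicOver iota x.

(* Matrices act on column vectors, whereas the predicate [eigenvalue] of
   mxalgebra is about the action on row vectors. *)
Definition is_eigenvector (F : fieldType) (n : nat) (M : 'M[F]_n) (a : F)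
    (u : 'cV[F]_n) : Prop :=
  u != 0 /\ M *m u = a *: u.

Definition is_eigenvalue (F : fieldType) (n : nat) (M : 'M[F]_n) (a : F) : Prop :=
  exists u : 'cV[F]_n, is_eigenvector M a u.

Section NumericalRange.

Variables (L : fieldType) (sigma : L -> L).

Definition herm_form (n : nat) (u v : 'cV[L]_n) : L :=
  \sum_(i < n) sigma (u i 0) * v i 0.

Definition definite_up_to (n : nat) : Prop :=
  forall u : 'cV[L]_n, u != 0 -> herm_form u u != 0.

Definition Num_range (n : nat) (M : 'M[L]_n) : set L :=
  [set herm_form u (M *m u) | u in [set u : 'cV[L]_n | herm_form u u = 1]].

(* Delta lies in the fixed field of sigma; it is kept as a subset of L. *)
Definition Delta : set L := [set a * sigma a | a in [set: L]].

Definition Delta2 : set L := [set a + b | a in Delta & b in Delta].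

Definition Delta_ellipse0 (E : set L) : Prop :=
  exists d1 d2 : L,
    [/\ (Delta `\ 0) d1, (Delta `\ 0) d2 &
        E = [set sigma p.1 * p.2 | p in
              [set p : L * L | d1 * p.1 * sigma p.1 + d2 * p.2 * sigma p.2 = 1]]].

End NumericalRange.

(* Main.v *)
(* Over the closure the eigenvalues c and tr M - c coincide, so tr M = 2c and
   det M = c^2: in characteristic not 2, c = tr M / 2, and in characteristic 2
   it is a square root of det M, which exists because X^2 - d is inseparable.
   An eigenvector with norm in Delta scales to a unit vector u (when
   Delta_2 = Delta every eigenvector qualifies), and its perpendicular
   v = (- s u_2, s u_1) is again a unit vector. In the orthonormal basis (u, v)
   M is upper triangular with diagonal (c, c) and corner b, and
   <xu + yv, M(xu + yv)> = c <xu + yv, xu + yv> + b s(x) y. Hence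
   (Num M - c) / b is the ellipse with d1 = d2 = 1. *)
Require Import Defs.
From HB Require Import structures.
From mathcomp Require Import all_boot all_order all_algebra all_fingroup all_field.
From mathcomp Require Import boolp classical_sets ring.

Set Implicit Arguments.
Unset Strict Implicit.
Unset Printing Implicit Defensive.

Import GRing.Theory.
Local Open Scope classical_set_scope.
Local Open Scope ring_scope.

(** * Eigenvalues as roots of the characteristic polynomial *)

Lemma is_eigenvalueP (F : fieldType) (n : nat) (M : 'M[F]_n) (a : F) :
  is_eigenvalue M a <-> \det (M - a%:M) = 0.
Proof.
(* [det0P] produces row vectors killed from the left, hence the passage to the transpose. *)
rewrite -det_tr; split=> [[u [u0 Mu]]|/eqP/det0P[v v0 vM]].
  apply/eqP/det0P; exists u^T; first by rewrite trmx_eq0.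
  by rewrite -trmx_mul mulmxBl mul_scalar_mx Mu subrr trmx0.
exists v^T; split; first by rewrite trmx_eq0.
apply/eqP; rewrite -subr_eq0 -mul_scalar_mx -mulmxBl -trmx_eq0.
by rewrite trmx_mul trmxK vM.
Qed.

(** The determinant criterion commutes with field embeddings, so an eigenvalue found over the
    closure descends without descending its eigenvector. *)
Lemma is_eigenvalue_map (F F' : fieldType) (f : {rmorphism F -> F'}) (n : nat)
    (M : 'M[F]_n) (a : F) :
  is_eigenvalue (map_mx f M) (f a) <-> is_eigenvalue M a.
Proof.
rewrite !is_eigenvalueP -map_scalar_mx -map_mxB det_map_mx.
by split=> [/eqP|->]; rewrite ?rmorph0 // fmorph_eq0 => /eqP.
Qed.

Lemma sum_ord2 (V : nmodType) (f : 'I_2 -> V) : \sum_i f i = f 0 + f 1.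
Proof. by rewrite big_ord_recl big_ord1; congr (_ + f _); apply: val_inj. Qed.

Lemma ord2P (P : 'I_2 -> Prop) : P 0 -> P 1 -> forall i, P i.
Proof. by move=> P0 P1 [[|[|//]] lti]; [congr P: P0|congr P: P1]; apply: val_inj. Qed.

Lemma det_mx22 (R : comNzRingType) (A : 'M[R]_2) :
  \det A = A 0 0 * A 1 1 - A 0 1 * A 1 0.
Proof.
rewrite (expand_det_row _ 0) sum_ord2 /cofactor !det_mx11 !mxE /=.
have -> : lift 0 0 = 1 :> 'I_2 by apply: val_inj.
have -> : lift 1 0 = 0 :> 'I_2 by apply: val_inj.
by rewrite expr0 expr1 mul1r mulN1r mulrN.
Qed.

Lemma is_eigenvalue22P (F : fieldType) (M : 'M[F]_2) (a : F) :
  is_eigenvalue M a <-> a ^+ 2 - \tr M * a + \det M = 0.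
Proof.
rewrite is_eigenvalueP; have -> // : \det (M - a%:M) = a ^+ 2 - \tr M * a + \det M.
rewrite /mxtrace sum_ord2 !det_mx22 !mxE /= !mulr1n !mulr0n; ring.
Qed.

(** The second root [\tr M - a] of the characteristic polynomial lies in [F] as well, so uniqueness
    applies to it over any field. *)
Lemma unique_eigenvalue_tr_det (F : fieldType) (M : 'M[F]_2) (a : F) :
  is_eigenvalue M a -> (forall b, is_eigenvalue M b -> b = a) ->
  \tr M = a + a /\ \det M = a ^+ 2.
Proof.
move=> /is_eigenvalue22P Ma uniq_a.
have trM : \tr M = a + a.
  rewrite -[X in X + _](uniq_a (\tr M - a)) ?subrK //.
  by apply/is_eigenvalue22P; rewrite -[RHS]Ma; ring.
by split=> //; apply/eqP; rewrite -subr_eq0 -[X in _ == X]Ma trM; apply/eqP; ring.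
Qed.

Lemma perfect_pchar2_sqrt (F : fieldType) (d : F) :
  2%N \in [pchar F] -> perfect_field F -> exists x : F, x ^+ 2 = d.
Proof.
move=> F2 perfF; apply: contrapT => nosqrt.
pose p : {poly F} := 'X^2 - d%:P.
have szp : size p = 3%N by rewrite size_XnsubC.
(* In degree 2, having no root suffices for irreducibility. *)
have : irreducible_poly p.
  apply: cubic_irreducible => [|x]; first by rewrite szp.
  apply/negP => /rootP; rewrite !hornerE => /eqP; rewrite subr_eq0 => /eqP xd.
  by apply: nosqrt; exists x.
move/perfF; rewrite unlock.
have -> : p^`() = 0.
  by rewrite derivB derivXn derivC subr0 -scaler_nat (pcharf0 F2) scale0r.
by rewrite coprimep0 -size_poly_eq1 szp.
Qed.

Lemma unique_eigenvalue_in_subfield (F F' : fieldType) (iota : {rmorphism F -> F'})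
    (M : 'M[F]_2) (c : F') :
  (2%N \notin [pchar F]) \/ perfect_field F ->
  is_eigenvalue (map_mx iota M) c ->
  (forall c', is_eigenvalue (map_mx iota M) c' -> c' = c) ->
  exists c0, c = iota c0.
Proof.
move=> charF Mc uniq_c.
have [trM detM] := unique_eigenvalue_tr_det Mc uniq_c.
rewrite trace_map_mx det_map_mx in trM detM.
have [F2|nF2] := boolP (2%N \in [pchar F]).
  have [|x xd] := @perfect_pchar2_sqrt F (\det M) F2.
    by case: charF; rewrite ?F2.
  exists x; apply/eqP.
  have F'2 : 2%N \in [pchar F'] by rewrite (fmorph_pchar iota).
  (* Both [c] and [iota x] square to [iota (\det M)], and squaring is injective in characteristic
     2. *)
  rewrite -subr_eq0 -sqrf_eq0 sqrrB -detM -xd rmorphXn /=.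
  by rewrite mulrn_pchar // subr0 (addrr_pchar2 F'2).
have n2 : 2%:R != 0 :> F' by rewrite -(rmorph_nat iota) fmorph_eq0.
exists (\tr M / 2%:R); rewrite fmorph_div trM rmorph_nat; field; exact: n2.
Qed.

(** * The hermitian form on the plane *)

Section HermitianPlane.

Variables (L : fieldType) (s : {rmorphism L -> L}).
Hypothesis sK : involutive s.

Lemma herm_form2 (u v : 'cV[L]_2) :
  herm_form s u v = s (u 0 0) * v 0 0 + s (u 1 0) * v 1 0.
Proof. exact: sum_ord2. Qed.

Lemma herm_formDr (n : nat) (u v w : 'cV[L]_n) :
  herm_form s u (v + w) = herm_form s u v + herm_form s u w.
Proof. by rewrite -big_split; apply: eq_bigr => i _; rewrite mxE mulrDr. Qed.

Lemma herm_formZr (n : nat) (u v : 'cV[L]_n) (a : L) :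
  herm_form s u (a *: v) = a * herm_form s u v.
Proof. by rewrite big_distrr; apply: eq_bigr => i _; rewrite mxE mulrCA. Qed.

Lemma herm_formDl (n : nat) (u v w : 'cV[L]_n) :
  herm_form s (v + w) u = herm_form s v u + herm_form s w u.
Proof.
by rewrite -big_split; apply: eq_bigr => i _; rewrite mxE rmorphD mulrDl.
Qed.

Lemma herm_formZl (n : nat) (u v : 'cV[L]_n) (a : L) :
  herm_form s (a *: v) u = s a * herm_form s v u.
Proof. by rewrite big_distrr; apply: eq_bigr => i _; rewrite mxE rmorphM -mulrA. Qed.

Definition herm_formE := (herm_formDr, herm_formDl, herm_formZr, herm_formZl).

(** The conjugates give a vector orthogonal to [u] of the same norm, with no division as in
    Gram-Schmidt. *)
Definition perp (u : 'cV[L]_2) : 'cV[L]_2 :=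
  \col_i (if i == 0 then - s (u 1 0) else s (u 0 0)).

Lemma herm_form_perpr (u : 'cV[L]_2) : herm_form s u (perp u) = 0.
Proof. by rewrite herm_form2 !mxE /=; ring. Qed.

Lemma herm_form_perpl (u : 'cV[L]_2) : herm_form s (perp u) u = 0.
Proof. by rewrite herm_form2 !mxE /= rmorphN !sK; ring. Qed.

Lemma herm_form_perp (u : 'cV[L]_2) :
  herm_form s (perp u) (perp u) = herm_form s u u.
Proof. by rewrite !herm_form2 !mxE /= rmorphN !sK; ring. Qed.

Lemma perp_decomp (u w : 'cV[L]_2) : herm_form s u u = 1 ->
  w = herm_form s u w *: u + herm_form s (perp u) w *: perp u.
Proof.
move=> uu; apply/colP; move: uu; rewrite !herm_form2 => uu.
apply: ord2P; rewrite !mxE /= rmorphN !sK;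
  (* Multiplying the left side by [1] and writing this [1] as the norm of [u] leaves a polynomial
     identity. *)
  by rewrite -[LHS]mul1r -[X in X * _ = _]uu; ring.
Qed.

(** * Triangular form in an orthonormal basis *)

Section OrthonormalEigenbasis.

Variables (M : 'M[L]_2) (c : L) (u : 'cV[L]_2).
Hypotheses (uu : herm_form s u u = 1) (Mu : M *m u = c *: u).
Hypothesis uniq_c : forall a, is_eigenvalue M a -> a = c.

Let b := herm_form s u (M *m perp u).

(** The second diagonal entry of a triangular matrix is also an eigenvalue, so uniqueness forces it
    to be [c]. *)
Lemma mul_perp_eigenvector : M *m perp u = b *: u + c *: perp u.
Proof.
have := perp_decomp (M *m perp u) uu.
rewrite -/b; set d := herm_form s (perp u) _ => Mv.
have [<- //|dc] := eqVneq d c.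
(* were d different from c, b u + (d - c) (perp u) would be a d-eigenvector *)
case/eqP: (dc); apply: uniq_c; exists (b *: u + (d - c) *: perp u); split.
  apply: contra_neq dc => w0; apply/eqP; rewrite -subr_eq0.
  (* Pairing with [perp u] isolates the coefficient [d - c]. *)
  have := congr1 (herm_form s (perp u)) w0.
  rewrite !herm_formE herm_form_perpl herm_form_perp uu mulr0 add0r mulr1 => ->.
  by rewrite /herm_form big1 // => i _; rewrite [X in _ * X]mxE mulr0.
rewrite mulmxDr -!scalemxAr Mu Mv !scalerDr !scalerA addrA -scalerDl.
by congr (_ *: _ + _ *: _); ring.
Qed.

Lemma mul_perp_coef_neq0 : M <> c%:M -> b != 0.
Proof.
apply: contra_not_neq => b0; apply/eqP; rewrite -subr_eq0; apply/eqP.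
apply/matrixP => i j.
(* If [b = 0], then [M] acts as [c] on both basis vectors, hence [M - c%:M] kills each standard
   vector and all its columns vanish. *)
have: (M - c%:M) *m (delta_mx j 0) = 0 :> 'cV_2.
  rewrite mulmxBl mul_scalar_mx (perp_decomp (delta_mx j 0) uu).
  rewrite mulmxDr -!scalemxAr Mu mul_perp_eigenvector b0 scale0r add0r.
  by rewrite scalerDr !scalerA ![c * _]mulrC subrr.
by move/colP=> /(_ i); rewrite -colE !mxE.
Qed.

(** The factors [1] keep the parameter set in the literal shape of [Delta_ellipse0] with both
    coefficients equal to [1]. *)
Lemma Num_range_eigenbasis :
  Num_range s M = [set c + b * (s p.1 * p.2) | p in
    [set p : L * L | 1 * p.1 * s p.1 + 1 * p.2 * s p.2 = 1]].
Proof.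
have formE x y : let w := x *: u + y *: perp u in
    herm_form s w w = 1 * x * s x + 1 * y * s y /\
    herm_form s w (M *m w) = c * herm_form s w w + b * (s x * y).
  rewrite /= mulmxDr -!scalemxAr Mu mul_perp_eigenvector !herm_formE.
  rewrite herm_form_perpl herm_form_perpr herm_form_perp uu; split; ring.
apply/seteqP; split=> z.
  move=> [w /= ww <-]; exists (herm_form s u w, herm_form s (perp u) w) => /=.
    by have [<- _] := formE (herm_form s u w) (herm_form s (perp u) w);
      rewrite -perp_decomp.
  have [_] := formE (herm_form s u w) (herm_form s (perp u) w).
  by rewrite -perp_decomp // => ->; rewrite ww mulr1.
move=> [[x y] /= xy <-]; have /= [ww wMw] := formE x y.
by exists (x *: u + y *: perp u); rewrite /= ?wMw ww xy ?mulr1.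
Qed.

End OrthonormalEigenbasis.

(** The size is [n.+1] because in dimension 0 there is no unit vector and the range is empty. *)
Lemma Num_range_scalar (n : nat) (c : L) : Num_range s (c%:M : 'M[L]_n.+1) = [set c].
Proof.
have cM (u : 'cV[L]_n.+1) : herm_form s u u = 1 -> herm_form s u (c%:M *m u) = c.
  by move=> uu; rewrite mul_scalar_mx herm_formZr uu mulr1.
apply/seteqP; split=> [_ [u /= uu <-]|_ ->]; first exact: cM.
have ee : herm_form s (delta_mx 0 0 : 'cV[L]_n.+1) (delta_mx 0 0) = 1.
  rewrite /herm_form (bigD1 0) //= big1 ?addr0 ?mxE ?rmorph1 ?mulr1 //=.
  by move=> i i0; rewrite !mxE (negPf i0) mulr0.
by exists (delta_mx 0 0 : 'cV[L]_n.+1); [exact: ee | exact: cM].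
Qed.

(** If the norm of [u] is [d * s d], definiteness gives [d != 0], and [d^-1 *: u] has norm 1. *)
Lemma unit_eigenvector (n : nat) (M : 'M[L]_n) (a : L) (u : 'cV[L]_n) :
  definite_up_to s n -> is_eigenvector M a u -> Delta s (herm_form s u u) ->
  exists v, herm_form s v v = 1 /\ M *m v = a *: v.
Proof.
move=> def_s [/def_s u0 Mu] [d _ du]; move: u0; rewrite -du mulf_eq0 => /norP[d0 sd0].
exists (d^-1 *: u); rewrite !herm_formE -du fmorphV; split; first by field; rewrite sd0 d0.
by rewrite -scalemxAr Mu !scalerA mulrC.
Qed.

Lemma Delta2_herm_form (u : 'cV[L]_2) : Delta2 s (herm_form s u u).
Proof.
rewrite herm_form2; exists (s (u 0 0) * u 0 0); first by exists (u 0 0); rewrite // mulrC.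
by exists (s (u 1 0) * u 1 0) => //; exists (u 1 0); rewrite // mulrC.
Qed.

Lemma Num_range_unique_eigenvalue (M : 'M[L]_2) (c : L) :
  definite_up_to s 2 ->
  is_eigenvalue M c -> (forall a, is_eigenvalue M a -> a = c) ->
  Delta2 s = Delta s \/
    (exists (a : L) (u : 'cV[L]_2), is_eigenvector M a u /\ Delta s (herm_form s u u)) ->
  (M = c%:M /\ Num_range s M = [set c]) \/
  (exists e f : L, f != 0 /\
     Delta_ellipse0 s [set (z - e) / f | z in Num_range s M]).
Proof.
move=> def_s [u Mu] uniq_c ex_unit.
have [v [vv Mv]] : exists v, herm_form s v v = 1 /\ M *m v = c *: v.
  case: ex_unit => [D2|[a [v [Mv Dv]]]].
    by apply: unit_eigenvector Mu _ => //; rewrite -D2; exact: Delta2_herm_form.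
  (* The eigenvector is given with some eigenvalue [a], which uniqueness identifies with [c]. *)
  rewrite -(uniq_c a); first exact: unit_eigenvector Mv Dv.
  by exists v.
have [->|/eqP Mc] := eqVneq M c%:M; first by left; split=> //; exact: Num_range_scalar.
right; exists c, (herm_form s v (M *m perp v)).
have b0 := mul_perp_coef_neq0 vv Mv uniq_c Mc; split=> //.
have Delta1 : (Delta s `\ 0) 1.
  split; last exact/eqP/oner_neq0.
  by exists 1; rewrite // rmorph1 mulr1.
exists 1, 1; split=> //.
rewrite (Num_range_eigenbasis vv Mv uniq_c) image_comp.
(* The affine map undoes the parametrisation: [(c + b * z - c) / b = z]. *)
by apply: eq_imagel => p _ /=; rewrite addrC addKr mulrC mulKf.
Qed.

End HermitianPlane.

(** * The Galois conjugation and the conclusion *)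

Lemma galois_dim2_involutive (K : fieldType) (L : splittingFieldType K)
    (sigma : gal_of {:L}) :
  \dim {:L} = 2%N -> galois 1 {:L} -> 'Gal({:L} / 1)%g = <[sigma]>%g ->
  involutive sigma.
Proof.
move=> dimL /galois_dim galL gal_sigma x.
rewrite -galM ?memvf //; have <- : (sigma ^+ 2 = sigma * sigma)%g by [].
(* The generator [sigma] has the order of the Galois group, which is the degree 2 of the
   extension. *)
suff -> : (sigma ^+ 2 = 1)%g by rewrite gal_id.
have <- : #[sigma]%g = 2%N by rewrite /order -gal_sigma -galL dimL dimv1.
exact: expg_order.
Qed.

Theorem proposition5 (K : fieldType) (L : splittingFieldType K)
  (sigma : gal_of {:L})
  (hdeg : \dim {:L} = 2%N)
  (hgal : galois 1 {:L})
  (hsigma : 'Gal({:L} / 1)%g = <[sigma]>%g)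
  (hchar : (2%N \notin [pchar L]) \/ perfect_field L)
  (hdef : definite_up_to sigma 2)
  (Lbar : closedFieldType) (iota : {rmorphism L -> Lbar})
  (hbar : algebraic_closure iota)
  (M : 'M[L]_2) (c : Lbar)
  (hc : is_eigenvalue (map_mx iota M) c)
  (hcuniq : forall c' : Lbar, is_eigenvalue (map_mx iota M) c' -> c' = c) :
  exists c0 : L, c = iota c0 /\
    (Delta2 sigma = Delta sigma \/
       (exists (a : L) (u : 'cV[L]_2),
          is_eigenvector M a u /\ Delta sigma (herm_form sigma u u)) ->
     (M = c0%:M /\ Num_range sigma M = [set c0]) \/
     (exists e f : L, f != 0 /\
        Delta_ellipse0 sigma [set (z - e) / f | z in Num_range sigma M])).
Proof.
have [c0 cE] := unique_eigenvalue_in_subfield hchar hc hcuniq.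
exists c0; split=> //.
apply: Num_range_unique_eigenvalue => //.
- exact: galois_dim2_involutive hdeg hgal hsigma.
- by apply/(is_eigenvalue_map iota); rewrite -cE.
(* Uniqueness over the closure restricts to [L] because [iota] is injective. *)
- move=> a /(is_eigenvalue_map iota)/hcuniq; rewrite cE; exact: fmorph_inj.
Qed.
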